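(* Let $p$ be a prime and let $G$ be a $2$-closed subgroup of $S_{p^2}$ that contains the left regular representation $(\mathbb{Z}_{p^2})_L$ of $\mathbb{Z}_{p^2}$. Then one of the following is true: (1) $G=S_{p^2}$; (2) $G\le N_{S_{p^2}}\bigl((\mathbb{Z}_{p^2})_L\bigr)$; (3) $G=G_1\wr G_2$, where $G_1$ and $G_2$ are $2$-closed groups of degree $p$.
   Context: For a transitive group $G$ on $\Omega$, let $G$ act on $\Omega\times\Omega$ by $g(\alpha,\beta)=(g(\alpha),g(\beta))$. For each orbit $\mathcal{O}$ other than the diagonal, the digraph with vertex set $\Omega$ and arc set $\mathcal{O}$ is an orbital digraph of $G$. The $2$-closure $\mathrm{cl}(G)$ is the intersection of the automorphism groups of all orbital digraphs of $G$, and $G$ is $2$-closed if $\mathrm{cl}(G)=G$. $S_{p^2}$ acts on $\mathbb{Z}_{p^2}$, identified with $\mathbb{Z}_p\times\mathbb{Z}_p$ via $(a,b)\mapsto a+bp$ ($0\le a,b\le p-1$); $(\mathbb{Z}_{p^2})_L$ is the group of translations of $\mathbb{Z}_{p^2}$. For $G_1,G_2\le S_p$, $G_1\wr G_2$ is the imprimitive wreath product: all permutations $(i,j)\mapsto(g(i),h_i(j))$ with $g\in G_1$ and $h_i\in G_2$ for each $i\in\mathbb{Z}_p$. *)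

(* Defs.v *)
From HB Require Import structures.
From mathcomp Require Import all_boot all_order all_algebra all_fingroup.

Set Implicit Arguments.
Unset Strict Implicit.
Unset Printing Implicit Defensive.

Import GRing.Theory.
Local Open Scope group_scope.

Section TwoClosure.
Variable T : finType.
Implicit Types (G : {set {perm T}}) (O : {set T * T}).

Definition pair_perm (u : T * T) (s : {perm T}) : T * T := (s u.1, s u.2).

Lemma pair_perm1 : pair_perm^~ 1 =1 id.
Proof. by case=> x y; rewrite /pair_perm !perm1. Qed.

Lemma pair_permM u : act_morph pair_perm u.
Proof. by move=> s t; rewrite /pair_perm /= !permM. Qed.

Canonical pair_action := TotalAction pair_perm1 pair_permM.

Definition diagonal : {set T * T} := [set (x, x) | x in T].

(* An orbital digraph on T is represented by its arc set. *)
Definition orbital_digraphs G : {set {set T * T}} :=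
  [set O in [set orbit pair_action G u | u in [set: T * T]] | O != diagonal].

Definition digraph_aut O : {set {perm T}} :=
  [set s : {perm T} |
    [forall x, forall y, ((s x, s y) \in O) == ((x, y) \in O)]].

Lemma digraph_autP O (s : {perm T}) :
  reflect (forall x y, ((s x, s y) \in O) = ((x, y) \in O))
          (s \in digraph_aut O).
Proof.
rewrite inE; apply: (iffP forallP) => [sO x y | sO x].
  by have /forallP/(_ y)/eqP := sO x.
by apply/forallP=> y; rewrite sO.
Qed.

Lemma digraph_aut_group_set O : group_set (digraph_aut O).
Proof.
apply/group_setP; split=> [|s t /digraph_autP sO /digraph_autP tO].
  by apply/digraph_autP=> x y; rewrite !perm1.
by apply/digraph_autP=> x y; rewrite !permM tO sO.
Qed.
Canonical digraph_aut_group O := Group (digraph_aut_group_set O).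

Definition two_closure G : {set {perm T}} :=
  \bigcap_(O in orbital_digraphs G) digraph_aut O.

(* The 2-closure is only considered for transitive groups, so transitivity is
   part of being 2-closed. *)
Definition two_closed G : bool :=
  [transitive G, on [set: T] | 'P] && (two_closure G == G).

End TwoClosure.

Section LeftRegular.
Variable V : finZmodType.

Definition translation (c : V) : {perm V} := perm (@addrI V c).

Definition left_regular : {set {perm V}} := [set translation c | c in V].

Lemma left_regular_group_set : group_set left_regular.
Proof.
apply/group_setP; split=> [|_ _ /imsetP[c _ ->] /imsetP[d _ ->]].
  by apply/imsetP; exists 0%R => //; apply/permP=> x; rewrite perm1 permE add0r.
by apply/imsetP; exists (d + c)%R => //; apply/permP=> x; rewrite permM !permE addrA.
Qed.
Canonical left_regular_group := Group left_regular_group_set.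

End LeftRegular.

(* For p > 1 the elements a, b of 'Z_p coerce to their representatives in
   {0, ..., p - 1}, and the sum below is then less than p ^ 2. *)
Definition Zp2_of_pair (p : nat) (a b : 'Z_p) : 'Z_(p ^ 2) :=
  inZp (a + b * p)%N.

Definition wreath (p : nat) (G1 G2 : {set {perm 'Z_p}}) :
    {set {perm 'Z_(p ^ 2)}} :=
  [set s : {perm 'Z_(p ^ 2)} |
    [exists g in G1, exists h : {ffun 'Z_p -> {perm 'Z_p}},
       [forall i, h i \in G2]
       && [forall i, forall j,
             s (Zp2_of_pair i j) == Zp2_of_pair (g i) (h i j)]]].

(* Main.v *)
(* Let B x be the orbit of x under the stabiliser of 0 in G.  Since G contains
   the translations, s y - s x lies in B (y - x) for every s in G, and as G is
   2-closed this property characterises G.  The matrices over F_q that commute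
   with G form a ring, and taking q-th powers in it gives Schur's theorems:
   B (u x) = u B x for every unit u, and the set of those w which are hit by
   t |-> q t a number of times prime to q, t in a union of sets B x, is again such
   a union (also for q = p).  Write P for the nonunits of Z_(p^2), i.e., the
   subgroup of order p, and K for the group of the units in B 1.
   - If K meets 1 + P trivially, the second theorem for q = p shows that
     B p is contained in p K, hence s y - s x = k (y - x) with k in K depending
     on x and y; comparing the differences for x, y and y + p shows that k is
     constant, so that s is affine.
   - Otherwise K is a union of cosets of P.  If B 1 has no element in P, then
     G is the wreath product of the groups preserving the sets B x modulo P
     and inside P.  If z is an element of P in B 1, counting the
     representations of 1 and of z as differences of elements of B 1 gives
     p <= 2 |B 1 n P|, so that B 1 meets, hence equals, each of its multiples
     u B 1, and G is 2-transitive. *)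
Require Import Defs.
From mathcomp Require Import all_boot all_order all_algebra all_fingroup.
From mathcomp Require Import ring.

Set Implicit Arguments.
Unset Strict Implicit.
Unset Printing Implicit Defensive.

Local Open Scope group_scope.

(** * Basic sets of a group containing the translations, and their unions *)

Section BasicSets.
Import GRing.Theory.
Local Open Scope ring_scope.
Variables (n : nat) (G : {group {perm 'Z_n}}).
Hypothesis regG : left_regular 'Z_n \subset G.
Implicit Types (x y z u t : 'Z_n) (X : {set 'Z_n}) (s : {perm 'Z_n}).

Definition basic_set x : {set 'Z_n} := orbit 'P 'C_G[0 | 'P] x.

(** Stability under the stabiliser of 0, i.e., [X] is a union of basic sets. *)
Definition S_set X := forall s x, s \in G -> s 0 = 0 -> x \in X -> s x \in X.

Lemma basic_setP x y :
  reflect (exists s, [/\ s \in G, s 0 = 0 & s x = y]) (y \in basic_set x).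
Proof.
apply: (iffP orbitP) => [[s /setIP[sG /astab1P s0] sx]|[s [sG s0 sx]]].
  by exists s.
by exists s => //; apply/setIP; split=> //; apply/astab1P.
Qed.

Lemma basic_set_refl x : x \in basic_set x.
Proof. exact: orbit_refl. Qed.

Lemma basic_set_sym x y : (x \in basic_set y) = (y \in basic_set x).
Proof. exact: orbit_sym. Qed.

Lemma basic_set_trans x y z :
  x \in basic_set y -> y \in basic_set z -> x \in basic_set z.
Proof. exact: orbit_trans. Qed.

Lemma basic_set_eq x y : y \in basic_set x -> basic_set y = basic_set x.
Proof. by move/orbit_eqP. Qed.

Lemma basic_set_S x : S_set (basic_set x).
Proof.
move=> s y sG s0 yx; apply: basic_set_trans yx.
by apply/basic_setP; exists s.
Qed.

Lemma S_set_basic X x y : S_set X -> x \in X -> y \in basic_set x -> y \in X.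
Proof. by move=> SX xX /basic_setP[s [sG s0 <-]]; apply: SX. Qed.

Lemma translationE c x : translation c x = c + x.
Proof. exact: permE. Qed.

Lemma translation_mem x : translation x \in G.
Proof. by apply: (subsetP regG); apply: imset_f. Qed.

Lemma basic_set_sub s x y : s \in G -> s y - s x \in basic_set (y - x).
Proof.
(* Products act from left to right: 0 goes to x, then to s x, then back to 0, while y - x goes to s
   y - s x. *)
move=> sG; apply/basic_setP; exists (translation x * s * translation (- s x))%g.
split; first by rewrite !groupM ?translation_mem.
  by rewrite !permM !permE addr0 addNr.
by rewrite !permM !permE addrC [x + _]addrC subrK.
Qed.

Lemma S_set_sub X s x y : S_set X -> s \in G ->
  (s y - s x \in X) = (y - x \in X).
Proof.
move=> SX sG; apply/idP/idP => H; apply: (S_set_basic SX H).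
  by rewrite basic_set_sym basic_set_sub.
exact: basic_set_sub.
Qed.

Lemma S_set_stable X s x : S_set X -> s \in G -> s 0 = 0 -> (s x \in X) = (x \in X).
Proof. by move=> SX sG s0; rewrite -[s x]subr0 -s0 S_set_sub // subr0. Qed.

(** * Schur's theorems through matrices in characteristic q *)

Section Power.
Variables (q : nat) (q_pr : prime q).

(** The adjacency matrix over F_q of the Cayley digraph of [X], with ['Z_n] unfolded to its ordinal
    type as index set. *)
Definition adj X : 'M['F_q]_((Zp_trunc n).+2) :=
  \sum_(t in X) perm_mx (translation t).

Lemma adjE X i j : adj X i j = (j - i \in X)%:R.
Proof.
rewrite summxE; under eq_bigr do rewrite !mxE permE.
have [jiX | jiX] := boolP (j - i \in X).
  rewrite (bigD1 (j - i)) //= subrK eqxx big1 ?addr0 // => t /andP[_ tji].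
  by case: eqP => // e; case/eqP: tji; rewrite -e addrK.
by rewrite big1 // => t tX; case: eqP => // e; rewrite -e addrK tX in jiX.
Qed.

Lemma perm_mx_translationX t k :
  perm_mx (translation t) ^+ k = perm_mx (translation (t *+ k)) :> 'M['F_q]_((Zp_trunc n).+2).
Proof.
elim: k => [|k IHk].
  rewrite expr0 -[1]perm_mx1; congr perm_mx.
  by apply/permP=> x; rewrite perm1 permE mulr0n add0r.
rewrite exprS IHk -[_ * _]perm_mxM; congr perm_mx.
by apply/permP=> x; rewrite permM !permE addrA mulrSr.
Qed.

Lemma perm_mx_translation_comm t u :
  GRing.comm (perm_mx (translation t) : 'M['F_q]_((Zp_trunc n).+2))
    (perm_mx (translation u)).
Proof.
rewrite /GRing.comm -[_ * _]perm_mxM -[RHS]perm_mxM; congr perm_mx.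
by apply/permP=> x; rewrite !permM !permE addrCA.
Qed.

(** The translation matrices commute and the characteristic is q, so taking q-th powers is additive
    on their sum. *)
Lemma adjX X :
  adj X ^+ q = \sum_(t in X) perm_mx (translation (t *+ q)).
Proof.
have Mq: q \in [pchar 'M['F_q]_((Zp_trunc n).+2)] by rewrite pchar_lalg pchar_Fp.
rewrite -(pFrobenius_autE Mq) /adj -!big_enum.
elim: (enum _) => [|t r IHr]; first by rewrite !big_nil pFrobenius_aut0.
rewrite !big_cons pFrobenius_autD_comm ?IHr; last first.
  by apply: commr_sum => u _; apply: perm_mx_translation_comm.
by rewrite pFrobenius_autE perm_mx_translationX.
Qed.

Lemma perm_mx_comm s (A : 'M['F_q]_((Zp_trunc n).+2)) i j :
  GRing.comm (perm_mx s) A -> A (s i) (s j) = A i j.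
Proof.
rewrite /GRing.comm -[_ * _]row_permE -[s in RHS]invgK -[RHS]col_permE.
by move/matrixP/(_ i (s j)); rewrite !mxE permK.
Qed.

Lemma adj_comm X s : S_set X -> s \in G -> GRing.comm (perm_mx s) (adj X).
Proof.
move=> SX sG; rewrite /GRing.comm -[_ * _]row_permE -[RHS]/(adj X *m _).
rewrite -[s in RHS]invgK -col_permE; apply/matrixP=> i j.
by rewrite !mxE !adjE -{1}[j](permKV s) S_set_sub.
Qed.

(** The entry of [adj X ^+ q] at (0, w) is the number of t in [X] with q t = w, modulo q. This power
    commutes with the matrices of G, so its entries in row 0 are invariant under the stabiliser of
    0. *)
Lemma S_set_power X : S_set X ->
  S_set [set w | ~~ (q %| #|[set t in X | t *+ q == w]|)%N].
Proof.
move=> SX s w sG s0; rewrite !inE (dvdn_pcharf (pchar_Fp q_pr)).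
rewrite (dvdn_pcharf (pchar_Fp q_pr)).
have count i j : (adj X ^+ q) i j = #|[set t in X | t *+ q == j - i]|%:R.
  rewrite adjX summxE -sum1_card natr_sum.
  rewrite [RHS](eq_bigl (fun t => (t \in X) && (t *+ q == j - i))); last first.
    by move=> t; rewrite inE.
  rewrite big_mkcondr; apply: eq_bigr => t _; rewrite !mxE permE.
  by rewrite [_ == j - i]eq_sym subr_eq [j == _]eq_sym; case: eqP.
have /(commrX q) sA := adj_comm SX sG.
by have := count 0 w; rewrite -(perm_mx_comm _ _ sA) s0 count !subr0 => ->.
Qed.

End Power.
(** Multiplication by the unit q is injective, so each count in [S_set_power] is 0 or 1. *)
Lemma S_set_mul_prime q X : prime q -> (q%:R : 'Z_n) \is a GRing.unit ->
  S_set X -> S_set [set q%:R * t | t in X].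
Proof.
move=> q_pr uq /(S_set_power q_pr); congr S_set; apply/setP=> w; rewrite inE.
apply/idP/imsetP => [qX | [t tX ->]].
  have /set0Pn[t] : [set t in X | t *+ q == w] != set0.
    by apply: contraNneq qX => ->; rewrite cards0 dvdn0.
  by rewrite inE -(mulr_natl t) => /andP[tX /eqP<-]; exists t.
suff ->: [set t' in X | t' *+ q == q%:R * t] = [set t].
  by rewrite cards1 dvdn1; case: eqP q_pr => // ->.
apply/setP=> t'; rewrite !inE -(mulr_natl t') (inj_eq (mulrI uq)).
by apply: andb_idl => /eqP->.
Qed.

(** Strong induction on the representative of u, splitting off its least prime factor, which is
    again a unit. *)
Lemma S_set_mul u X : u \is a GRing.unit -> S_set X -> S_set [set u * t | t in X].
Proof.
rewrite -(natr_Zp u); move: (u : nat) => m {u}.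
have [k] := ubnP m; elim: k => // k IHk in m X *.
case: m => [|[|m]] mk; first by rewrite unitr0.
  by move=> _; congr S_set; rewrite -[LHS]imset_id; apply: eq_imset => t; rewrite mul1r.
have q_pr : prime (pdiv m.+2) by rewrite pdiv_prime.
rewrite -{1 2}(divnK (pdiv_dvd m.+2)) natrM unitrM => /andP[um uq] SX.
have -> : [set (m.+2 %/ pdiv m.+2)%:R * (pdiv m.+2)%:R * t | t in X] =
  [set (m.+2 %/ pdiv m.+2)%:R * t | t in [set (pdiv m.+2)%:R * t | t in X]].
  by rewrite -imset_comp; apply: eq_imset => t; rewrite /= mulrA.
apply: IHk um _; last exact: S_set_mul_prime.
by rewrite -ltnS (leq_trans _ mk) // ltnS ltn_Pdiv // prime_gt1.
Qed.

(** The set u^-1 B (u x) is a union of basic sets and contains x, hence contains B x. *)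
Lemma basic_set_mul u x y :
  u \is a GRing.unit -> y \in basic_set x -> u * y \in basic_set (u * x).
Proof.
move=> uu yx; have uxP : x \in [set u^-1 * t | t in basic_set (u * x)].
  by apply/imsetP; exists (u * x); rewrite ?basic_set_refl ?mulKr.
have uV : u^-1 \is a GRing.unit by rewrite unitrV.
have /imsetP[t tux ->] := S_set_basic (S_set_mul uV (@basic_set_S (u * x))) uxP yx.
by rewrite mulVKr.
Qed.

Lemma basic_set_mulE u x y : u \is a GRing.unit ->
  (u * y \in basic_set (u * x)) = (y \in basic_set x).
Proof.
move=> uu; apply/idP/idP; last exact: basic_set_mul.
by move/(basic_set_mul (_ : u^-1 \is a GRing.unit)); rewrite !mulKr // unitrV; apply.
Qed.

(** An element of G fixing 0 and taking x to y preserves [X] and membership of differences in [X],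
    so it maps one set onto the other. *)
Lemma card_difference X x y : S_set X -> y \in basic_set x ->
  #|[set t in X | t - y \in X]| = #|[set t in X | t - x \in X]|.
Proof.
move=> SX /basic_setP[s [sG s0 <-]].
rewrite -[RHS](card_imset _ (@perm_inj _ s)); apply/eq_card=> t.
rewrite -[t](permKV s) (mem_imset _ _ (@perm_inj _ s)) !inE.
by rewrite S_set_sub // S_set_stable.
Qed.

End BasicSets.

(** * The 2-closure and its description by basic sets *)

Section TwoClosedPermutations.
Variable T : finType.
Implicit Types (G : {group {perm T}}) (s : {perm T}).

(** Orbital digraphs omit the diagonal, but by transitivity it is a single orbit, preserved by every
    permutation. *)
Lemma two_closureP G s : [transitive G, on [set: T] | 'P] ->
  reflect (forall x y, (s x, s y) \in orbit (@pair_action T) G (x, y))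
          (s \in two_closure G).
Proof.
move=> trG.
have diag x y : (x, y) \in diagonal T = (x == y).
  by apply/imsetP/eqP => [[z _ [-> ->]]|<-] //; exists x.
have orbit_diag x : orbit (@pair_action T) G (x, x) = diagonal T.
  apply/setP=> -[y z]; rewrite diag; apply/orbitP/eqP => [[g _ [<- <-]]|<-] //.
  have [g gG ->] := atransP2 trG (in_setT x) (in_setT y).
  by exists g.
apply: (iffP bigcapP) => [sG x y | sG O /setIdP[/imsetP[u _ ->] Ou]].
  have [-> | xy] := eqVneq x y; first by rewrite orbit_diag diag.
  have xyO : orbit (@pair_action T) G (x, y) \in orbital_digraphs G.
    rewrite inE imset_f ?inE //=; apply: contraNneq xy => xyd.
    by rewrite -diag -xyd orbit_refl.
  by have /digraph_autP-> := sG _ xyO; apply: orbit_refl.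
by apply/digraph_autP=> x y; apply: orbit_transl; apply: sG.
Qed.

Lemma sub_two_closure G : [transitive G, on [set: T] | 'P] -> G \subset two_closure G.
Proof.
move=> trG; apply/subsetP=> s sG; apply/(two_closureP _ trG) => x y.
by apply/orbitP; exists s.
Qed.

End TwoClosedPermutations.

Section TwoClosed.
Import GRing.Theory.
Local Open Scope ring_scope.
Variables (n : nat) (G : {group {perm 'Z_n}}).
Hypotheses (regG : left_regular 'Z_n \subset G) (closG : two_closed G).
Implicit Types (x y : 'Z_n) (s : {perm 'Z_n}).

(** Translations move each pair to one starting at 0, so the orbit of (x, y) is determined by the
    basic set of y - x. *)
Lemma mem_two_closed s :
  (forall x y, s y - s x \in basic_set G (y - x)) -> s \in G.
Proof.
case/andP: closG => trG /eqP <- sT; apply/(two_closureP _ trG) => x y.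
have /basic_setP[g [gG g0 gxy]] := sT x y.
apply/orbitP; exists (translation (- x) * g * translation (s x))%g.
  by rewrite !groupM ?translation_mem.
rewrite /= /pair_perm /= !permM !permE addNr g0 addr0.
by rewrite [- x + y]addrC gxy addrC subrK.
Qed.

Variables (I : finType) (f : I -> 'Z_n).

(** The automorphism group of the colouring of pairs (i, j) by the basic set of f j - f i; both
    factors of the wreath product will have this form. *)
Definition pull_set : {set {perm I}} :=
  [set g : {perm I} | [forall i, forall j, f (g j) - f (g i) \in basic_set G (f j - f i)]].

Lemma pull_setP (g : {perm I}) :
  reflect (forall i j, f (g j) - f (g i) \in basic_set G (f j - f i)) (g \in pull_set).
Proof. by rewrite inE; apply: (iffP forallP) => H i; apply/forallP. Qed.

Lemma pull_group_set : group_set pull_set.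
Proof.
apply/group_setP; split=> [|g h /pull_setP gP /pull_setP hP].
  by apply/pull_setP=> i j; rewrite !perm1 basic_set_refl.
by apply/pull_setP=> i j; rewrite !permM (basic_set_trans (hP _ _)).
Qed.
Canonical pull_group := Group pull_group_set.

(** The defining condition concerns one pair at a time, and on each pair an element of the closure
    agrees with some element of [pull_set]. *)
Lemma pull_two_closed : [transitive pull_set, on [set: I] | 'P] -> two_closed pull_set.
Proof.
move=> trf; rewrite /two_closed trf eqEsubset (@sub_two_closure _ pull_group) // andbT.
apply/subsetP=> g /(@two_closureP _ pull_group g trf) gcl; apply/pull_setP=> i j.
by have /orbitP[h /pull_setP hP [<- <-]] := gcl i j; apply: hP.
Qed.

End TwoClosed.

(** * Units, nonunits and base-p digits in Z_(p^2) *)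

Section PrimeSquare.
Import GRing.Theory.
Local Open Scope ring_scope.
Variables (p : nat) (p_pr : prime p).
Local Notation V := 'Z_(p ^ 2).
Local Notation unit x := (x \is a @GRing.unit V).
Local Notation e := (@Zp2_of_pair p).
Implicit Types (x y z u t : V) (i j : 'Z_p).

Let p_gt1 : (1 < p)%N := prime_gt1 p_pr.
Let p2_gt1 : (1 < p ^ 2)%N.
Proof. by rewrite -(exp1n 2) ltn_exp2r. Qed.

Lemma natr_eqV a b : (a%:R == b%:R :> V) = (a == b %[mod p ^ 2])%N.
Proof. by rewrite -val_eqE /= !val_Zp_nat. Qed.

Lemma unit_modE x : unit x = ~~ (p %| x)%N.
Proof. by rewrite -{1}(natr_Zp x) unitZpE // coprime_pexpl // prime_coprime. Qed.

Lemma nonunit_subE x y : ~~ unit (x - y) = (x == y %[mod p])%N.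
Proof.
rewrite unit_modE negbK; set z := x - y.
have -> : x = y + z by rewrite /z addrC subrK.
rewrite -{1}(natr_Zp y) -{2}(natr_Zp z) -natrD val_Zp_nat // modn_dvdm ?dvdn_exp //.
by rewrite -[X in _ == X %[mod p]]addn0 eqn_modDl mod0n.
Qed.

Lemma unit_sub_neq x y : unit x -> ~~ unit y -> unit (x - y).
Proof.
move=> ux uy; apply: contraLR ux; rewrite nonunit_subE -{2}[x]subr0 => xy.
by move: uy; rewrite -{1}[y]subr0 !nonunit_subE (eqP xy).
Qed.

Lemma nonunit_sub x y : ~~ unit x -> ~~ unit y -> ~~ unit (x - y).
Proof.
rewrite -{1}[x]subr0 -{1}[y]subr0 !nonunit_subE => /eqP xP /eqP yP.
by rewrite xP yP.
Qed.

Lemma nonunit_mul x y : ~~ unit x -> ~~ unit (x * y).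
Proof. by rewrite unitrM negb_and => ->. Qed.

Lemma nonunit_mulp x : (p%:R * x == 0) = ~~ unit x.
Proof.
rewrite unit_modE negbK -{1}(natr_Zp x) -natrM -(mulr0n 1) natr_eqV mod0n.
by have := @dvdn_pmul2l p p x (ltnW p_gt1); rewrite mulnn.
Qed.

Lemma nonunit_p : ~~ unit p%:R.
Proof. by rewrite -nonunit_mulp -natrM -(mulr0n 1) natr_eqV mulnn modnn mod0n. Qed.

Lemma nonunitP x : reflect (exists y, x = p%:R * y) (~~ unit x).
Proof.
apply: (iffP idP) => [|[y ->]]; last exact: nonunit_mul nonunit_p.
rewrite unit_modE negbK => /dvdnP[k xk]; exists k%:R.
by rewrite -natrM mulnC -xk natr_Zp.
Qed.

Lemma nonunit_unitP x : ~~ unit x -> x != 0 -> exists2 u, unit u & x = p%:R * u.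
Proof.
case/nonunitP=> y -> py0; exists y => //.
by apply: contraNT py0; rewrite nonunit_mulp.
Qed.

Lemma nonunit_mul0 x y : ~~ unit x -> ~~ unit y -> x * y = 0.
Proof.
by case/nonunitP=> z -> uy; apply/eqP; rewrite -mulrA nonunit_mulp mulrC nonunit_mul.
Qed.

Lemma Zp2_of_pairE i j : e i j = (i + j * p)%:R.
Proof. by rewrite Zp_nat. Qed.

Lemma ltn_Zp i : (i < p)%N.
Proof. by rewrite -[p in (_ < p)%N]Zp_cast. Qed.

Lemma val_Zp2_of_pair i j : e i j = (i + j * p)%N :> nat.
Proof.
rewrite Zp2_of_pairE val_Zp_nat // modn_small // -mulnn.
apply: leq_trans (_ : j.+1 * p <= p * p)%N; first by rewrite mulSn ltn_add2r ltn_Zp.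
by rewrite leq_mul2r ltn_Zp orbT.
Qed.

Lemma val_inZp m : (inZp m : 'Z_p) = (m %% p)%N :> nat.
Proof. by rewrite /= Zp_cast. Qed.

Definition digit0 x : 'Z_p := inZp x.
Definition digit1 x : 'Z_p := inZp (x %/ p).

Lemma val_digit0 x : digit0 x = (x %% p)%N :> nat.
Proof. by rewrite -val_inZp. Qed.

Lemma val_digit1 x : digit1 x = (x %/ p)%N :> nat.
Proof.
rewrite val_inZp modn_small // ltn_divLR ?(ltnW p_gt1) // mulnn.
by have := ltn_ord x; move: (nat_of_ord x) => m; rewrite [X in (_ < X)%N]Zp_cast.
Qed.

Lemma digitsK x : e (digit0 x) (digit1 x) = x.
Proof.
by apply: ord_inj; rewrite val_Zp2_of_pair val_digit0 val_digit1 addnC -divn_eq.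
Qed.

Lemma unit_sub_digit0 x y : unit (x - y) = (digit0 x != digit0 y).
Proof. by apply: negb_inj; rewrite nonunit_subE negbK -(inj_eq (@ord_inj _)) !val_digit0. Qed.

Lemma unit_sub_Zp2 i j k l : unit (e i j - e k l) = (i != k).
Proof.
apply: negb_inj; rewrite nonunit_subE negbK !val_Zp2_of_pair ![(_ + _ * p)%N]addnC !modnMDl.
by rewrite !modn_small ?ltn_Zp.
Qed.

Lemma Zp2_of_pair_sub i j k l : e i j - e i k = e l j - e l k.
Proof. by rewrite !Zp2_of_pairE !natrD; ring. Qed.

Lemma Zp2_of_pair_inj i : injective (e i).
Proof.
move=> j k /(congr1 (@nat_of_ord _)); rewrite !val_Zp2_of_pair => /addnI/eqP.
by rewrite eqn_pmul2r ?(ltnW p_gt1) // => /eqP/ord_inj.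
Qed.

Lemma card_nonunit : #|[set x : V | ~~ unit x]| = p.
Proof.
rewrite -[RHS](Zp_cast p_gt1) -[RHS]card_ord -(card_imset _ (@Zp2_of_pair_inj 0)).
apply/eq_card=> x; rewrite inE; apply/idP/imsetP => [ux | [j _ ->]].
  exists (digit1 x) => //; rewrite -{1}[x]digitsK; congr e.
  apply: ord_inj; rewrite val_digit0.
  by apply/eqP; move: ux; rewrite unit_modE negbK.
by rewrite unit_modE negbK val_Zp2_of_pair dvdn_mull.
Qed.

(** * Basic sets over Z_(p^2) *)

Variable G : {group {perm V}}.
Hypothesis regG : left_regular V \subset G.
Local Notation B := (basic_set G).

Lemma basic_set0 x : x \in B 0 -> x = 0.
Proof. by case/basic_setP=> s [_ s0 <-]. Qed.

Lemma basic_set_unit u x : unit u -> (x \in B u) = (u^-1 * x \in B 1).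
Proof.
by move=> uu; rewrite -(basic_set_mulE regG 1 (u^-1 * x) uu) mulVKr // mulr1.
Qed.

(** Multiplication by x maps [B 1] onto [B x], which is [B 1]; thus the units in [B 1] form a group
    K. *)
Lemma basic1_mul x y : unit x -> x \in B 1 -> (x * y \in B 1) = (y \in B 1).
Proof.
by move=> ux x1; rewrite -{1}(basic_set_eq x1) (basic_set_unit _ ux) mulKr.
Qed.

Lemma basic1_neq0 x : x \in B 1 -> x != 0.
Proof.
move=> x1; apply: contraTneq isT => x0; have := oner_neq0 V.
by rewrite (@basic_set0 1) ?eqxx // -x0 basic_set_sym.
Qed.

(** * The affine case: K meets 1 + P trivially *)

Section Affine.
Hypothesis B1 : forall z, ~~ unit z -> 1 + z \in B 1 -> z = 0.

Lemma unit_nonunitD x y : unit x -> ~~ unit y -> unit (x + y).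
Proof.
move=> ux uy; rewrite -[y]opprK unit_sub_neq // -sub0r nonunit_sub //.
Qed.

(** The quotient l / k lies both in [B 1] and in 1 + P, hence is 1: elements of K are determined
    modulo p. *)
Lemma basic1_inj k l : unit k -> k \in B 1 -> l \in B 1 -> ~~ unit (l - k) -> l = k.
Proof.
move=> uk k1 l1 lk; apply/eqP; rewrite -subr_eq0 -(mulVKr uk (l - k)).
rewrite (@B1 (k^-1 * (l - k))) ?mulr0 // 1?mulrC ?nonunit_mul //.
by rewrite mulrC mulrBr mulVr // addrC subrK -(basic1_mul _ uk k1) mulVKr.
Qed.

(** By [basic1_inj], t = 1 is the only element of [B 1] with p t = p. So p is hit exactly once, and
    Schur's theorem for q = p puts all of [B p] in the image of [B 1]. *)
Lemma basic_set_p x : x \in B p%:R -> exists2 t, t \in B 1 & x = p%:R * t.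
Proof.
pose X := [set w | ~~ (p %| #|[set t in B 1%R | t *+ p == w]|)%N].
have SX : S_set G X by apply: S_set_power => //; apply: basic_set_S.
have pX : p%:R \in X.
  rewrite inE (_ : [set t in _ | _] = [set 1]) ?cards1 ?dvdn1 ?gtn_eqF //.
  apply/setP=> t; rewrite !inE -[t *+ p]mulr_natl -subr_eq0 -[X in _ - X]mulr1 -mulrBr.
  rewrite nonunit_mulp; apply/andP/eqP=> [[t1 tu]|->].
    by apply: basic1_inj; rewrite ?unitr1 ?basic_set_refl.
  by rewrite basic_set_refl subrr unitr0.
move=> /(S_set_basic SX pX); rewrite inE => xX.
have /set0Pn[t] : [set t in B 1 | t *+ p == x] != set0.
  by apply: contraNneq xX => ->; rewrite cards0 dvdn0.
by rewrite inE -(mulr_natl t) => /andP[t1 /eqP<-]; exists t.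
Qed.

Lemma basic_set_nonunit x y : ~~ unit x -> y \in B x ->
  exists k, [/\ unit k, k \in B 1 & y = x * k].
Proof.
move=> ux; have [-> /basic_set0-> | x0] := eqVneq x 0.
  by exists 1; rewrite unitr1 basic_set_refl mul0r.
have [u uu xE] := nonunit_unitP ux x0; rewrite xE => yx.
have : u^-1 * y \in B p%:R.
  by rewrite -(basic_set_mulE regG _ _ uu) mulVKr // mulrC.
case/basic_set_p=> t t1 ytE; exists t; split=> //; last first.
  by rewrite -mulrA mulrCA -ytE mulVKr.
apply: contraNT x0; rewrite -nonunit_mulp -ytE => /eqP uy0.
rewrite xE; apply/eqP; apply: basic_set0.
by rewrite -(mulr0 u) -uy0 mulVKr // basic_set_sym.
Qed.

Lemma basic_set_mem_mul x y : y \in B x ->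
  exists k, [/\ unit k, k \in B 1 & y = x * k].
Proof.
have [ux | /basic_set_nonunit] := boolP (unit x); last exact.
move=> yx; exists (x^-1 * y); rewrite -basic_set_unit // mulVKr //; split=> //.
(* If y were a nonunit, the previous lemma applied to x in [B y] would make x one too. *)
rewrite unitrM unitrV ux /=; apply: contraTT ux => uy.
move: yx; rewrite basic_set_sym => /(basic_set_nonunit uy)[k [_ _ ->]].
exact: nonunit_mul.
Qed.

Lemma affine_of_basic s : s \in G -> exists k, forall x y, s y - s x = (y - x) * k.
Proof.
move=> sG.
have ks x y : exists k, [/\ unit k, k \in B 1 & s y - s x = (y - x) * k].
  by apply: basic_set_mem_mul; apply: basic_set_sub.
have kappaP x : exists k, [&& unit k, k \in B 1 &
    s (x + p%:R) - s x == (x + p%:R - x) * k].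
  by have [k [uk k1 /eqP E]] := ks x (x + p%:R); exists k; rewrite uk k1.
(* The multiplier on the pair (x, x + p), a candidate for the constant slope of s. *)
pose kappa x := xchoose (kappaP x).
have kappaE x y : unit (y - x) -> s y - s x = (y - x) * kappa y.
  move=> uyx; have /and3P[] := xchooseP (kappaP y).
  rewrite -/(kappa y); move: (kappa y) => k2 uk2 k21 /eqP E2.
  have [k1 [uk1 k11 E1]] := ks x y.
  have [k3 [uk3 k31 E3]] := ks x (y + p%:R).
  (* k1, k2, k3 are the multipliers on (x, y), (y, y + p), (x, y + p). The right side is a nonunit,
     so k1 and k3 agree modulo p and coincide; then p (k3 - k2) = 0 gives k2 = k3. *)
  have E : (y - x) * (k1 - k3) = p%:R * (k3 - k2).
    have {E2}E2 : s (y + p%:R) - s y = p%:R * k2 by rewrite E2; ring.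
    have -> : (y - x) * (k1 - k3) =
        (s (y + p%:R) - s x) - (s (y + p%:R) - s y) - (y - x) * k3.
      by rewrite mulrBr -E1; ring.
    by rewrite E2 E3; ring.
  have k13 : k1 = k3.
    apply: basic1_inj => //.
    by have := nonunit_mul (k3 - k2) nonunit_p; rewrite -E unitrM uyx.
  suff -> : k2 = k3 by rewrite E1 k13.
  apply: esym; apply: basic1_inj => //.
  by rewrite -nonunit_mulp -E k13 subrr mulr0.
have kappa_eq x y : unit (y - x) -> kappa x = kappa y.
  move=> uyx; apply: (mulrI uyx); rewrite -kappaE // -opprB mulNr.
  by rewrite -kappaE ?opprB // -unitrN opprB.
have kappa0 x : kappa x = kappa 0.
  have [ux | ux] := boolP (unit x); first by apply/esym/kappa_eq; rewrite subr0.
  (* A nonunit x is compared with 0 through 1, which differs from both by a unit. *)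
  rewrite (@kappa_eq x 1) ?unit_sub_neq ?unitr1 //.
  by apply: esym; apply: kappa_eq; rewrite subr0 unitr1.
exists (kappa 0) => x y.
have [uyx | uyx] := boolP (unit (y - x)); first by rewrite kappaE // kappa0.
(* If y - x is a nonunit, the point x + 1 differs from both x and y by a unit. *)
have ux1 : unit (x + 1 - x) by rewrite addrAC subrr add0r unitr1.
have uyx1 : unit (y - (x + 1)).
  by rewrite opprD addrA -unitrN opprB unit_sub_neq ?unitr1.
rewrite -[s y](subrK (s (x + 1))) -addrA (kappaE x (x + 1)) // (kappaE (x + 1) y) //.
by rewrite !kappa0; ring.
Qed.

(** Conjugation by a map of slope k turns the translation by c into that by c k. *)
Lemma sub_norm_left_regular : G \subset 'N(left_regular V).
Proof.
apply/subsetP=> s /affine_of_basic[k kE]; rewrite inE.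
apply/subsetP=> _ /imsetP[_ /imsetP[c _ ->] ->].
apply/imsetP; exists (c * k) => //; apply/permP=> x.
rewrite !permM !translationE; apply/eqP; rewrite -subr_eq.
have := kE (s^-1%g x) (c + s^-1%g x); rewrite permKV => ->.
by rewrite addrK.
Qed.

End Affine.

(** * The other case: K contains 1 + P *)

Section Coset.
Variable z : V.
Hypotheses (uz : ~~ unit z) (z0 : z != 0) (z1 : 1 + z \in B 1).

(** Products of two nonunits vanish, so (1 + z)^m = 1 + m z; these powers exhaust 1 + P because z
    generates P. *)
Lemma basic1_coset w : ~~ unit w -> 1 + w \in B 1.
Proof.
have [-> | w0] := eqVneq w 0; first by rewrite addr0 basic_set_refl.
move=> uw; have [a ua zE] := nonunit_unitP uz z0.
have [b ub wE] := nonunit_unitP uw w0.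
have -> : w = z *+ (a^-1 * b)%R.
  by rewrite -mulr_natr natr_Zp zE wE -mulrA mulVKr.
elim: (nat_of_ord _) => [|m IHm]; first by rewrite mulr0n addr0 basic_set_refl.
have -> : 1 + z *+ m.+1 = (1 + z) * (1 + z *+ m).
  rewrite mulrDl mul1r mulrDr mulr1 nonunit_mul0 // ?addr0.
    by rewrite mulrSr addrA.
  by rewrite -mulr_natr nonunit_mul.
by rewrite basic1_mul // unit_nonunitD // unitr1.
Qed.

End Coset.

Section Cosets.
Hypothesis cosetB : forall z, ~~ unit z -> 1 + z \in B 1.
Hypothesis closG : two_closed G.

Lemma basic_set_coset x y : unit x -> ~~ unit (y - x) -> y \in B x.
Proof.
move=> ux yx; rewrite basic_set_unit //.
rewrite -[y](subrK x) addrC mulrDr mulVr // cosetB //.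
by rewrite mulrC nonunit_mul.
Qed.

(** * A nonunit in [B 1] forces the symmetric group *)

Section Full.
Variable z : V.
Hypotheses (uz : ~~ unit z) (z1 : z \in B 1).

Let Q := [set t in B 1 | ~~ unit t].

(** With [N x] counting the representations of x as a difference of elements of [B 1], the bound
    follows from |B 1| - |Q| <= |N z| = |N 1| <= |Q| + |B 1| - p. *)
Lemma card_basic1_nonunit : (p <= #|Q| + #|Q|)%N.
Proof.
pose N x := [set t in B 1 | t - x \in B 1].
have SB : S_set G (B 1) by apply: basic_set_S.
have NE : #|N z| = #|N 1| := card_difference regG SB z1.
have BQ : (#|B 1%R :&: Q| + #|B 1%R :\: Q| = #|B 1%R|)%N := cardsID _ _.
have QE : B 1 :&: Q = Q by apply/setIidPr/subsetP=> t /setIdP[].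
(* A unit t of [B 1] stays in [B 1] when z is subtracted, as t + P lies in [B t]. *)
have Nz : (#|B 1%R :\: Q| <= #|N z|)%N.
  apply/subset_leq_card/subsetP=> t; rewrite !inE negb_and negbK.
  move=> /andP[/orP[/negbTE->//|ut] t1]; rewrite t1 /=.
  apply: basic_set_trans t1; apply: basic_set_coset => //.
  by rewrite addrAC subrr add0r unitrN.
pose C := [set 1 + w | w in [set w : V | ~~ unit w]].
have Cp : #|C| = p by rewrite card_imset ?card_nonunit //; apply: addrI.
have CB : B 1 :&: C = C.
  by apply/setIidPr/subsetP=> _ /imsetP[w + ->]; rewrite inE => uw; apply: cosetB.
have BC : (#|B 1%R :&: C| + #|B 1%R :\: C| = #|B 1%R|)%N := cardsID _ _.
have NC : (#|N 1%R :&: C| + #|N 1%R :\: C| = #|N 1%R|)%N := cardsID _ _.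
have N1C : (#|N 1%R :\: C| <= #|B 1%R :\: C|)%N.
  by apply/subset_leq_card/setSD/subsetP=> t /setIdP[].
(* An element 1 + w of the coset [C] belongs to [N 1] only if w is in [Q]. *)
have N1Q : (#|N 1%R :&: C| <= #|Q|)%N.
  rewrite -[#|Q|](card_imset _ (@addrI V 1)); apply/subset_leq_card/subsetP=> t.
  case/setIP=> /setIdP[t1 t1B] /imsetP[w]; rewrite inE => uw tE.
  apply/imsetP; exists w => //; rewrite inE uw andbT.
  by move: t1B; rewrite tE addrAC subrr add0r.
rewrite QE in BQ; rewrite CB Cp in BC.
rewrite -(leq_add2r #|B 1 :\: C|) BC -BQ -addnA leq_add2l.
by rewrite (leq_trans Nz) // NE -NC leq_add.
Qed.

Lemma basic1_full x : x != 0 -> x \in B 1.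
Proof.
have z0 := basic1_neq0 z1.
have unitB u : unit u -> u \in B 1.
  move=> uu; pose uQ := [set u * t | t in Q].
  have uQc : #|uQ| = #|Q| by apply: card_imset; apply: mulrI.
  have : ~~ [disjoint uQ & Q].
    (* Disjointness would fit 2 |Q| >= p elements into the p - 1 nonzero nonunits. *)
    apply/negP=> dis; have := (leq_card_setU uQ Q).2; rewrite dis => /eqP cU.
    have := card_basic1_nonunit; rewrite -{1}uQc -cU leqNgt => /negP; apply.
    have := card_nonunit; rewrite (cardsD1 0) inE unitr0 add1n => cP.
    rewrite -[X in (_ < X)%N]cP ltnS; apply: subset_leq_card.
    apply/subsetP=> q; rewrite !inE => /orP[/imsetP[t /setIdP[t1 ut] ->]|/andP[q1 ->]].
      rewrite mulrC nonunit_mul // andbT mulrC -(mulr0 u) (inj_eq (mulrI uu)).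
      exact: basic1_neq0.
    by rewrite basic1_neq0.
  (* A common element u t, with t in [B 1], gives B u = B (u t) = B 1. *)
  rewrite -setI_eq0 => /set0Pn[_ /setIP[/imsetP[t /setIdP[t1 _] ->] /setIdP[ut1 _]]].
  rewrite -(basic_set_eq ut1) basic_set_sym -{2}[u]mulr1.
  exact: basic_set_mul.
move=> x0; have [/unitB // | ux] := boolP (unit x).
have [a ua zE] := nonunit_unitP uz z0.
have [b ub xE] := nonunit_unitP ux x0.
(* x is the multiple of z by the unit b / a, so it lies in (b / a) B 1 = B (b / a) = B 1. *)
have ba : b * a^-1 \in B 1 by apply: unitB; rewrite unitrM ub unitrV.
rewrite -(basic_set_eq ba) (_ : x = b * a^-1 * z); last first.
  by rewrite zE xE mulrCA divrK.
by rewrite -{2}[b * _]mulr1; apply: basic_set_mul; rewrite // unitrM ub unitrV.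
Qed.

Lemma full_of_nonunit : G :=: [set: {perm V}].
Proof.
apply/eqP; rewrite eqEsubset subsetT /=; apply/subsetP=> s _.
apply: mem_two_closed => // x y.
have [-> | xy] := eqVneq x y; first by rewrite !subrr basic_set_refl.
have yx : y - x \in B 1 by rewrite basic1_full // subr_eq0 eq_sym.
by rewrite (basic_set_eq yx) basic1_full // subr_eq0 (inj_eq perm_inj) eq_sym.
Qed.

End Full.

(** * The wreath product case: [B 1] consists of units *)

Section Wreath.
Hypothesis unitB : forall x, x \in B 1 -> unit x.

Lemma basic_set_unitE x y : y \in B x -> unit y = unit x.
Proof.
have H u v : v \in B u -> unit u -> unit v.
  by move=> vu uu; move: vu; rewrite basic_set_unit // => /unitB; rewrite unitrM => /andP[].
by move=> yx; apply/idP/idP; apply: H; rewrite // basic_set_sym.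
Qed.

Lemma unit_perm_sub s x y : s \in G -> unit (s y - s x) = unit (y - x).
Proof. by move=> sG; apply/basic_set_unitE/basic_set_sub. Qed.

(** [G1] acts on the cosets of P through the representatives [e i 0], and [G2] on P itself, whose
    elements are the [e 0 j]. *)
Let G1 := pull_group G (fun i => e i 0).
Let G2 := pull_group G (e 0).

Lemma wreath_factor (s : {perm V}) : s \in G ->
  exists2 g, g \in G1 & exists2 h : {ffun 'Z_p -> {perm 'Z_p}},
    (forall i, h i \in G2) & (forall i j, s (e i j) = e (g i) (h i j)).
Proof.
move=> sG.
(* s preserves whether a difference is a unit, hence permutes the cosets of P. *)
have s0 i j : digit0 (s (e i j)) = digit0 (s (e i 0)).
  by apply/eqP; rewrite -[_ == _]negbK -unit_sub_digit0 unit_perm_sub // unit_sub_Zp2 eqxx.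
have g_inj : injective (fun i => digit0 (s (e i 0))).
  move=> i j /eqP; rewrite -[_ == _]negbK -unit_sub_digit0 unit_perm_sub //.
  by rewrite unit_sub_Zp2 negbK => /eqP.
have h_inj i : injective (fun j => digit1 (s (e i j))).
  move=> j k jk; apply/(@Zp2_of_pair_inj i)/(@perm_inj _ s).
  by rewrite -[LHS]digitsK -[RHS]digitsK jk !s0.
pose h := [ffun i => perm (@h_inj i)].
have sE i j : s (e i j) = e (perm g_inj i) (h i j).
  by rewrite ffunE !permE -[LHS]digitsK s0.
exists (perm g_inj).
  apply/pull_setP=> i j; have [-> | ij] := eqVneq i j.
    by rewrite !subrr basic_set_refl.
  have sT := basic_set_sub regG (e i 0) (e j 0) sG.
  apply: basic_set_trans sT; rewrite !sE; apply: basic_set_coset.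
    by rewrite unit_sub_Zp2 (inj_eq perm_inj) eq_sym.
  (* Replacing the second digits by 0 changes the unit difference only by a nonunit, so its basic
     set is unchanged. *)
  rewrite (_ : _ - _ = (e (perm g_inj j) 0 - e (perm g_inj j) (h j 0)) -
      (e (perm g_inj i) 0 - e (perm g_inj i) (h i 0))); last by ring.
  by rewrite nonunit_sub // unit_sub_Zp2 eqxx.
exists h => // i; apply/pull_setP=> j k.
(* Differences within a coset of P do not depend on the coset, so [h i] can be tested on P. *)
rewrite (Zp2_of_pair_sub 0 _ _ (perm g_inj i)) -!sE.
by rewrite (Zp2_of_pair_sub 0 k j i) basic_set_sub.
Qed.

(** Differences within a coset of P are controlled by [h]. Between distinct cosets they are units,
    whose basic sets depend only on the residues modulo p, controlled by [g]. *)
Lemma wreath_mem (s : {perm V}) (g : {perm 'Z_p}) (h : {ffun 'Z_p -> {perm 'Z_p}}) :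
  g \in G1 -> (forall i, h i \in G2) ->
  (forall i j, s (e i j) = e (g i) (h i j)) -> s \in G.
Proof.
move=> /pull_setP gP hP sE; apply: mem_two_closed => // x y.
rewrite -[x]digitsK -[y]digitsK.
move: (digit0 x) (digit1 x) (digit0 y) (digit1 y) => i j k l {x y}.
have [-> | ik] := eqVneq i k.
  rewrite !sE (Zp2_of_pair_sub _ _ _ 0) (Zp2_of_pair_sub k _ _ 0).
  by have /pull_setP := hP k; apply.
have Bc i1 j1 k1 l1 : i1 != k1 -> e k1 l1 - e i1 j1 \in B (e k1 0 - e i1 0).
  move=> ik1; apply: basic_set_coset; first by rewrite unit_sub_Zp2 eq_sym.
  rewrite (_ : _ - _ = (e k1 l1 - e k1 0) - (e i1 j1 - e i1 0)); last by ring.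
  by rewrite nonunit_sub // unit_sub_Zp2 eqxx.
rewrite !sE; apply: basic_set_trans (Bc _ _ _ _ _) _.
  by rewrite (inj_eq perm_inj).
by apply: basic_set_trans (gP i k) _; rewrite basic_set_sym Bc.
Qed.

Lemma wreath_of_unit : exists G1 G2 : {group {perm 'Z_p}},
  [/\ two_closed G1, two_closed G2 & G :=: wreath G1 G2].
Proof.
exists G1, G2; split.
- apply: pull_two_closed; apply/imsetP; exists 0 => //; apply/setP=> i.
  rewrite inE; apply/esym/orbitP.
  (* Transitivity of [G1]: the translation taking [e 0 0] to [e i 0] induces a [g] with g 0 = i. *)
  have [g gG1 [h _ sE]] := wreath_factor (translation_mem regG (e i 0 - e 0 0)).
  exists g => //; apply/eqP; rewrite -[_ == _]negbK -(unit_sub_Zp2 _ (h 0 0) _ 0).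
  by rewrite -sE translationE subrK subrr unitr0.
- apply: pull_two_closed; apply/imsetP; exists 0 => //; apply/setP=> j.
  rewrite inE; apply/esym/orbitP.
  (* Transitivity of [G2]: this translation fixes the coset P, so g 0 = 0 and [h 0] takes 0 to j. *)
  have [g gG1 [h hG2 sE]] := wreath_factor (translation_mem regG (e 0 j - e 0 0)).
  exists (h 0); first exact: hG2.
  rewrite /= /aperm; apply: (@Zp2_of_pair_inj (g 0)); rewrite -sE translationE subrK.
  have g0 : g 0 = 0.
    apply/eqP; rewrite -[_ == _]negbK -(unit_sub_Zp2 _ (h 0 0) _ j).
    by rewrite -sE translationE subrK subrr unitr0.
  by rewrite g0.
apply/setP=> s; rewrite inE; apply/idP/exists_inP => [sG | [g gG1]].
  have [g gG1 [h hG2 sE]] := wreath_factor sG.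
  exists g => //; apply/existsP; exists h; apply/andP; split.
    by apply/forallP=> i.
  by apply/forallP=> i; apply/forallP=> j; rewrite sE.
case/existsP=> h /andP[/forallP hG2 /forallP sE].
by apply: (wreath_mem gG1 hG2) => i j; apply/eqP; move/forallP: (sE i).
Qed.

End Wreath.
End Cosets.
End PrimeSquare.

Theorem theorem15 (p : nat) (hp : prime p) (G : {group {perm 'Z_(p ^ 2)}})
    (hG : two_closed G) (hL : left_regular 'Z_(p ^ 2) \subset G) :
  [\/ G :=: [set: {perm 'Z_(p ^ 2)}],
      G \subset 'N(left_regular 'Z_(p ^ 2))
    | exists G1 G2 : {group {perm 'Z_p}},
        [/\ two_closed G1, two_closed G2 & G :=: wreath G1 G2]].
Proof.
pose nonunit (z : 'Z_(p ^ 2)) := z \isn't a GRing.unit.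
pose B1 := basic_set G 1%R.
have [/existsP[z /and3P[uz z0 z1]] | noz] :=
    boolP [exists z, [&& nonunit z, z != 0%R & (1 + z)%R \in B1]]; last first.
  apply: Or32; apply: sub_norm_left_regular => // z uz z1.
  by apply: contraNeq noz => z0; apply/existsP; exists z; apply/and3P.
have cosetB := basic1_coset hp hL uz z0 z1.
have [/existsP[t /andP[ut t1]] | not1] := boolP [exists t, nonunit t && (t \in B1)].
  by apply: Or31; apply: full_of_nonunit ut t1.
apply: Or33; apply: wreath_of_unit => // x x1.
by apply: contraNT not1 => ux; apply/existsP; exists x; apply/andP.
Qed.
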